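(* Let $m,n$ be positive integers and let $A\in H_m$ and $B\in H_n$ be such that the Cayley transform of $A\otimes B$ satisfies $U_{A\otimes B}=C'\otimes D'$ for some $C'\in M_m$ and $D'\in M_n$. Then there exist $C\in H_m$ and $D\in H_n$ such that $U_{A\otimes B}=U_C\otimes U_D$.
   Context: $M_n$ denotes the algebra of $n\times n$ complex matrices, $H_n\subset M_n$ the set of Hermitian matrices, $I_n$ the $n\times n$ identity matrix, and $\otimes$ the Kronecker product. For a Hermitian matrix $X\in H_k$ (any $k$), the Cayley transform of $X$ is the unitary matrix $U_X=(X-iI_k)(X+iI_k)^{-1}$. *)

(* Defs.v *)
From mathcomp Require Import all_boot all_order all_algebra.
From mathcomp Require Import spectral sesquilinear reals.
From mathcomp.real_closed Require Import complex mxtens.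

Set Implicit Arguments.
Unset Strict Implicit.
Unset Printing Implicit Defensive.

Import Order.TTheory GRing.Theory Num.Theory.
Local Open Scope ring_scope.

(* [invmx] is a genuine inverse here when X is Hermitian: the eigenvalues of X
   are then real, so X + i I is invertible. *)
Definition cayley (R : realType) (k : nat) (X : 'M[R[i]]_k) : 'M[R[i]]_k :=
  (X - ('i%C)%:M) *m invmx (X + ('i%C)%:M).

(* Main.v *)
(* The unitarity of V (x) W makes V V^* and W W^* scalar with inverse scalars, so
   V (x) W = (s V) (x) (s^-1 W) with both factors unitary. The factors may still
   be changed by opposite phases, and since they have finitely many eigenvalues
   some phase makes 1 an eigenvalue of neither; a unitary matrix without
   eigenvalue 1 is the Cayley transform of a Hermitian matrix. *)
Require Import Defs.
From mathcomp Require Import all_boot all_order all_algebra.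
From mathcomp Require Import spectral sesquilinear reals.
From mathcomp.real_closed Require Import complex mxtens.
From mathcomp Require Import ring.

Set Implicit Arguments.
Unset Strict Implicit.
Unset Printing Implicit Defensive.

Import Order.TTheory GRing.Theory Num.Theory.
Local Open Scope ring_scope.

Section NumClosedField.
Local Open Scope sesquilinear_scope.
Variable C : numClosedFieldType.

Lemma is_hermsymP (n : nat) (X : 'M[C]_n) :
  reflect (X ^t* = X) (X \is hermsymmx).
Proof.
by apply: (iffP (is_hermitianmxP _ _ _)); rewrite expr0 scale1r => /esym.
Qed.

Lemma subr_scalar (n : nat) (X : 'M[C]_n) (a : C) :
  X - a%:M = X + (- a)%:M.
Proof. by rewrite raddfN. Qed.

Lemma adjoint_addr_scalar (n : nat) (X : 'M[C]_n) (a : C) :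
  (X + a%:M) ^t* = X ^t* + (a^*)%:M.
Proof. by rewrite linearD map_mxD /= tr_scalar_mx map_scalar_mx. Qed.

Lemma unitmx_subr_scalar (n : nat) (X : 'M[C]_n) (a : C) :
  (X - a%:M \in unitmx) = ~~ eigenvalue X a.
Proof. by rewrite negbK kermx_eq0 row_free_unit. Qed.

Lemma hermsym_eigenvalue_real (n : nat) (X : 'M[C]_n) (a : C) :
  X \is hermsymmx -> eigenvalue X a -> a \is Num.real.
Proof.
move=> /is_hermsymP hX /eigenvalueP[v vX v_neq0].
have vX' : X *m v ^t* = a^* *: v ^t*.
  by rewrite -{1}hX -map_mxM -trmx_mul vX linearZ map_mxZ.
have : a *: (v *m v ^t*) = a^* *: (v *m v ^t*).
  by rewrite scalemxAl -vX -mulmxA vX' -scalemxAr.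
move=> /matrixP/(_ 0 0); rewrite [LHS]mxE [RHS]mxE -dotmxE => /eqP.
rewrite -subr_eq0 -mulrBl mulf_eq0 dnorm_eq0 (negPf v_neq0) orbF subr_eq0.
by move=> /eqP aE; apply/CrealP.
Qed.

Lemma i_nonreal : ('i : C) \isn't Num.real.
Proof.
apply/negP => /CrealP; rewrite conjCi => /eqP.
by rewrite eq_sym -addr_eq0 -mulr2n mulrn_eq0 /= (negPf (neq0Ci C)).
Qed.

Lemma hermsym_unitmx (n : nat) (X : 'M[C]_n) :
  X \is hermsymmx -> (X - 'i%:M \in unitmx) /\ (X + 'i%:M \in unitmx).
Proof.
move=> hX; have -> : X + 'i%:M = X - (- 'i)%:M by rewrite subr_scalar opprK.
rewrite !unitmx_subr_scalar.
by split; apply/negP => /(hermsym_eigenvalue_real hX);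
  rewrite ?realN (negPf i_nonreal).
Qed.

(** Taking adjoints swaps [X - 'i%:M] and [X + 'i%:M], and the two commute, so the transform times
    its adjoint cancels to the identity. *)
Lemma cayley_unitarymx (n : nat) (X : 'M[C]_n) :
  X \is hermsymmx -> (X - 'i%:M) *m invmx (X + 'i%:M) \is unitarymx.
Proof.
move=> hX; have [uN uP] := hermsym_unitmx hX.
have XE : X ^t* = X by apply/is_hermsymP.
apply/unitarymxP; rewrite trmx_mul map_mxM trmx_inv map_invmx.
rewrite subr_scalar !adjoint_addr_scalar XE -subr_scalar rmorphN /= conjCi opprK.
rewrite -subr_scalar.
set N := X - _; set P := X + _.
have NP : N *m P = P *m N.
  have XN : X *m N = N *m X by rewrite mulmxBr mulmxBl scalar_mxC.
  by rewrite [RHS]mulmxDl XN -[in RHS]scalar_mxC -mulmxDr.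
have -> : N *m invmx P = invmx P *m N.
  by rewrite -[in RHS](mulmxK uP N) NP !mulmxA mulVmx ?mul1mx.
by rewrite mulmxA mulmxK // mulVmx.
Qed.

Lemma unitarymx_cayley (n : nat) (V : 'M[C]_n) :
  V \is unitarymx -> ~~ eigenvalue V 1 ->
  exists2 X : 'M[C]_n, X \is hermsymmx &
    (X - 'i%:M) *m invmx (X + 'i%:M) = V.
Proof.
move=> hV; rewrite -unitmx_subr_scalar; set Q := V - _ => uQ.
have VV : V ^t* *m V = 1%:M by apply/mulmx1C/unitarymxP.
(* Solving V = (X - i) (X + i)^-1 for X. *)
pose X := - 'i *: ((V + 1%:M) *m invmx Q).
have XQ : X *m Q = - 'i *: (V + 1%:M) by rewrite -scalemxAl mulmxKV.
have QE : Q ^t* = V ^t* - 1%:M.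
  by rewrite /Q subr_scalar adjoint_addr_scalar rmorphN rmorph1 -subr_scalar.
have uQ' : Q ^t* \in unitmx by rewrite map_unitmx unitmx_tr.
have hX : X \is hermsymmx.
  (* Multiplying by [Q] on the right and by its adjoint on the left clears both inverses. By [VV],
     each side is then ['i] times the difference of [V] and its adjoint. *)
  apply/is_hermsymP/(can_inj (mulmxK uQ)); rewrite XQ.
  rewrite linearZ /= map_mxZ trmx_mul map_mxM trmx_inv map_invmx /=.
  rewrite rmorphN /= conjCi opprK -scalemxAl adjoint_addr_scalar rmorph1.
  apply: (can_inj (mulKmx uQ')); rewrite -scalemxAr !mulmxA mulmxV // mul1mx.
  rewrite -scalemxAr scaleNr -scalerN QE; congr (_ *: _).
  rewrite mulmxBr !mulmxDl mulNmx mulmxDr !mul1mx !mulmx1 VV.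
  by apply/matrixP => i j; rewrite !mxE; ring.
exists X => //; have [_ uX] := hermsym_unitmx hX.
(* It remains to compare [X - 'i%:M] with [V *m (X + 'i%:M)]; after right multiplication by [Q] both
   become [-2i V]. *)
apply: (can_inj (mulmxK uX)); rewrite mulmxKV //; apply: (can_inj (mulmxK uQ)).
have XiQ : (X + 'i%:M) *m Q = (- 'i * 2)%:M.
  rewrite mulmxDl XQ mul_scalar_mx.
  by apply/matrixP => i j; rewrite !mxE; ring.
rewrite -mulmxA XiQ mulmxBl XQ mul_scalar_mx mul_mx_scalar.
by apply/matrixP => i j; rewrite !mxE; ring.
Qed.

Lemma exists_unit_nonroot (p : {poly C}) :
  p != 0 -> exists2 z : C, `|z| = 1 & ~~ root p z.
Proof.
move=> p_neq0.
have addi_neq0 (k : nat) : k%:R + 'i != 0 :> C.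
  rewrite addr_eq0; apply: contraNneq i_nonreal => /(congr1 -%R).
  by rewrite opprK => <-; rewrite realN realn.
(* Scalar Cayley transforms of the naturals: infinitely many distinct points of the unit circle, of
   which the first [size p] already outnumber the roots of [p]. *)
pose z (k : nat) : C := (k%:R - 'i) / (k%:R + 'i).
have z1 k : `|z k| = 1.
  rewrite normf_div -(norm_conjC (k%:R - 'i)) raddfB /= conjCi opprK.
  by rewrite conjC_nat divff ?normr_eq0.
have z_inj : injective z.
  move=> k l /eqP; rewrite eqr_div // => /eqP kl.
  have : 2 * 'i * (k%:R - l%:R) = 0 :> C.
    transitivity ((k%:R - 'i) * (l%:R + 'i) - (l%:R - 'i) * (k%:R + 'i) : C).
      by ring.
    by rewrite kl subrr.
  move=> /eqP; rewrite !mulf_eq0 pnatr_eq0 (negPf (neq0Ci C)) /= subr_eq0.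
  by rewrite eqr_nat => /eqP.
have [/max_poly_roots max_p|] := boolP (all (root p) (map z (iota 0 (size p)))).
  have := max_p p_neq0; rewrite size_map size_iota ltnn map_inj_uniq //.
  by rewrite iota_uniq => /(_ isT).
by move=> /allPn[_ /mapP[k _ ->] rk]; exists (z k).
Qed.

(** On the unit circle [z^-1] is the conjugate of [z], so the condition on [W] says that [z] is not
    a root of the conjugated characteristic polynomial. One product polynomial thus handles both
    conditions. *)
Lemma exists_phase_noneigenvalue (m n : nat) (V : 'M[C]_m) (W : 'M[C]_n) :
  exists z : C, [/\ `|z| = 1, ~~ eigenvalue V z & ~~ eigenvalue W z^-1].
Proof.
pose p := char_poly V * map_poly Num.conj (char_poly W).
have p_neq0 : p != 0.
  by rewrite mulf_neq0 ?map_poly_eq0 ?monic_neq0 ?char_poly_monic.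
have [z z1] := exists_unit_nonroot p_neq0.
rewrite rootM negb_or => /andP[zV zW]; exists z.
rewrite !eigenvalue_root_char invC_norm z1 expr1n invr1 mul1r; split=> //.
by rewrite -(fmorph_root Num.conj) /= conjCK.
Qed.

Lemma scale_unitarymx (n : nat) (z : C) (V : 'M[C]_n) :
  `|z| = 1 -> V \is unitarymx -> z *: V \is unitarymx.
Proof.
move=> z1 /unitarymxP hV; apply/unitarymxP.
by rewrite linearZ map_mxZ -scalemxAr -scalemxAl hV scalerA mulrC -normCK z1
  expr1n scale1r.
Qed.

Lemma eigenvalue_scale (n : nat) (z a : C) (V : 'M[C]_n) :
  z != 0 -> eigenvalue (z *: V) a = eigenvalue V (z^-1 * a).
Proof.
move=> z0; apply/eigenvalueP/eigenvalueP => -[v vV v0]; exists v => //.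
  by rewrite -scalerA -vV -scalemxAr scalerA mulVf ?scale1r.
by rewrite -scalemxAr vV scalerA mulrA divff ?mul1r.
Qed.

Lemma tens_scale (m n : nat) (z : C) (V : 'M[C]_m) (W : 'M[C]_n) :
  z != 0 -> (z *: V) *t (z^-1 *: W) = V *t W.
Proof.
move=> z0; apply/matrixP => i j.
by rewrite !mxE mulrACA divff ?mul1r.
Qed.

Lemma tens_unitarymx (m n : nat) (V : 'M[C]_m) (W : 'M[C]_n) :
  (0 < m)%N -> (0 < n)%N -> V *t W \is unitarymx ->
  exists s : C, [/\ s != 0, s *: V \is unitarymx & s^-1 *: W \is unitarymx].
Proof.
(* Positive sizes make the index [0] available; the entries [E 0 0] and [F 0 0] serve as references
   below. *)
case: m V => // m V _; case: n W => // n W _ /unitarymxP.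
rewrite trmx_tens map_mxT tensmx_mul.
set E := V *m _; set F := W *m _ => EF.
have EFE i i' j j' : E i i' * F j j' = ((i == i') && (j == j'))%:R.
  by rewrite -tensmxE EF mxE (can_eq (@mxtens_indexK _ _)).
have E0 : 0 <= E 0 0.
  by rewrite /E mxE sumr_ge0 // => i _; rewrite !mxE -normCK exprn_ge0.
have EF0 : E 0 0 * F 0 0 = 1 by rewrite EFE !eqxx.
have E_neq0 : E 0 0 != 0.
  by apply: contra_eq_neq EF0 => ->; rewrite mul0r eq_sym oner_neq0.
(* [E 0 0] is the squared norm of a row of [V], so dividing [V] by its square root [s] normalizes
   that row; [W] is multiplied by [s] to compensate. *)
pose s := sqrtC (E 0 0).
have s_neq0 : s != 0 by rewrite sqrtC_eq0.
have sE : s * s^* = E 0 0.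
  by rewrite (CrealP _) -?expr2 ?sqrtCK // ger0_real // sqrtC_ge0.
(* Fixing the indices of one factor at [0] in [EFE] and dividing by its nonzero corner entry shows
   that the other factor is scalar. *)
have EE : E = (E 0 0)%:M.
  apply/matrixP => i i'; rewrite [RHS]mxE -mulr_natl.
  have := EFE i i' 0 0; rewrite eqxx andbT => <-.
  by rewrite -mulrA [F _ _ * _]mulrC EF0 mulr1.
have FE : F = (E 0 0)^-1%:M.
  apply/matrixP => j j'; rewrite [RHS]mxE -mulr_natl.
  have := EFE 0 0 j j'; rewrite eqxx /= => <-.
  by rewrite mulrC mulKf.
exists s^-1; split; rewrite ?invr_eq0 ?invrK //; apply/unitarymxP;
  rewrite linearZ /= map_mxZ -scalemxAr -scalemxAl scalerA.
  rewrite -/E EE scale_scalar_mx /= fmorphV -invfM mulrC [_ * s]mulrC sE.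
  by rewrite divff.
by rewrite -/F FE scale_scalar_mx [_ * s]mulrC sE divff.
Qed.

Lemma tens_unitarymx_cayley (m n : nat) (V : 'M[C]_m) (W : 'M[C]_n) :
  V \is unitarymx -> W \is unitarymx ->
  exists (X : 'M[C]_m) (Y : 'M[C]_n), [/\ X \is hermsymmx, Y \is hermsymmx &
    ((X - 'i%:M) *m invmx (X + 'i%:M)) *t ((Y - 'i%:M) *m invmx (Y + 'i%:M)) =
    V *t W].
Proof.
move=> uV uW; have [z [z1 zV zW]] := exists_phase_noneigenvalue V W.
have z_neq0 : z != 0 by rewrite -normr_eq0 z1 oner_eq0.
have zV_neq0 : z^-1 != 0 by rewrite invr_eq0.
have zV1 : `|z^-1| = 1 by rewrite normfV z1 invr1.
(* [1] is an eigenvalue of [z^-1 *: V] exactly when [z] is one of [V], and of [z *: W] exactly when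
   [z^-1] is one of [W]; the choice of [z] excludes both. *)
have [|X hX XE] := unitarymx_cayley (scale_unitarymx zV1 uV).
  by rewrite eigenvalue_scale // invrK mulr1.
have [|Y hY YE] := unitarymx_cayley (scale_unitarymx z1 uW).
  by rewrite eigenvalue_scale // mulr1.
exists X, Y; split=> //; rewrite XE YE -[in z *: _](invrK z).
exact: tens_scale.
Qed.

End NumClosedField.

Theorem theorem2p4 (R : realType) (m n : nat) (m_gt0 : (0 < m)%N)
    (n_gt0 : (0 < n)%N) (A : 'M[R[i]]_m) (B : 'M[R[i]]_n)
    (A_herm : A \is hermsymmx) (B_herm : B \is hermsymmx)
    (C' : 'M[R[i]]_m) (D' : 'M[R[i]]_n) (hCD' : cayley (A *t B) = C' *t D') :
  exists (C : 'M[R[i]]_m) (D : 'M[R[i]]_n),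
    [/\ C \is hermsymmx, D \is hermsymmx &
        cayley (A *t B) = cayley C *t cayley D].
Proof.
have AB_herm : A *t B \is hermsymmx.
  apply/is_hermsymP; rewrite trmx_tens map_mxT.
  by rewrite (is_hermsymP _ A_herm) (is_hermsymP _ B_herm).
(* Identifies the concrete imaginary unit of [R[i]] with the ['i] of a general closed field. *)
have cayleyE k (X : 'M[R[i]]_k) :
    cayley X = (X - 'i%:M) *m invmx (X + 'i%:M) by rewrite -complexiE.
have := cayley_unitarymx AB_herm; rewrite -cayleyE hCD'.
move=> /(tens_unitarymx m_gt0 n_gt0)[s [s_neq0 uC uD]].
have [C [D [hC hD CDE]]] := tens_unitarymx_cayley uC uD.
by exists C, D; split=> //; rewrite !cayleyE CDE tens_scale.
Qed.
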